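(* Let $p\ge 1$ and let $\Gamma:\Omega\to\mathcal{K}_c(\mathbb{R}^p)$ be a compact convex random set on a probability space $(\Omega,\mathcal{A},\mathbb{P})$. Then for every $\alpha\in[0,1]$ the set $$D_\alpha=\{K\in\mathcal{K}_c(\mathbb{R}^p):D_{CT}(K;\Gamma)\ge\alpha\}$$ is a convex subset of $\mathcal{K}_c(\mathbb{R}^p)$.
   Context: $\mathcal{K}_c(\mathbb{R}^p)$ denotes the set of non-empty compact convex subsets of $\mathbb{R}^p$, and $\mathbb{S}^{p-1}=\{x\in\mathbb{R}^p:\|x\|=1\}$ the Euclidean unit sphere. The support function of $K\in\mathcal{K}_c(\mathbb{R}^p)$ is $s_K:\mathbb{S}^{p-1}\to\mathbb{R}$, $s_K(u)=\sup_{k\in K}\langle k,u\rangle$. For $K,L\in\mathcal{K}_c(\mathbb{R}^p)$ and $\gamma\ge 0$, $K+L=\{k+l:k\in K,l\in L\}$ and $\gamma\cdot K=\{\gamma k:k\in K\}$. A set $U\subseteq\mathcal{K}_c(\mathbb{R}^p)$ is convex if $(1-\lambda)\cdot K+\lambda\cdot L\in U$ for all $K,L\in U$ and all $\lambda\in[0,1]$. A map $\Gamma:\Omega\to\mathcal{K}_c(\mathbb{R}^p)$ on a probability space $(\Omega,\mathcal{A},\mathbb{P})$ is a compact convex random set if $\{\omega\in\Omega:\Gamma(\omega)\cap K\ne\emptyset\}\in\mathcal{A}$ for all $K\in\mathcal{K}_c(\mathbb{R}^p)$; equivalently, it is Borel measurable with respect to the Hausdorff metric. For $u\in\mathbb{S}^{p-1}$,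 $t\in\mathbb{R}$, define the halfspaces $S^-_{u,t}=\{K\in\mathcal{K}_c(\mathbb{R}^p):s_K(u)\le t\}$ and $S^+_{u,t}=\{K\in\mathcal{K}_c(\mathbb{R}^p):s_K(u)\ge t\}$. The Tukey depth of $K\in\mathcal{K}_c(\mathbb{R}^p)$ with respect to $\Gamma$ is $$D_{CT}(K;\Gamma)=\min\Big\{\inf_{u\in\mathbb{S}^{p-1},\,t\in\mathbb{R}:\ K\in S^-_{u,t}}\mathbb{P}(\Gamma\in S^-_{u,t}),\ \inf_{u\in\mathbb{S}^{p-1},\,t\in\mathbb{R}:\ K\in S^+_{u,t}}\mathbb{P}(\Gamma\in S^+_{u,t})\Big\}.$$ *)

(* Defs.v *)
From HB Require Import structures.
From mathcomp Require Import all_boot all_order all_algebra.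
From mathcomp Require Import all_classical all_reals all_analysis.
Import Order.TTheory GRing.Theory Num.Theory.
Import numFieldNormedType.Exports.

Set Implicit Arguments.
Unset Strict Implicit.
Unset Printing Implicit Defensive.

Local Open Scope classical_set_scope.
Local Open Scope ring_scope.

(* R^p is 'rV[R]_p. The library norm on matrices is the sup norm, so the
   Euclidean inner product and norm are introduced here; both norms induce
   the library's topology, which is the one used in [compact]. *)
Definition inner (R : realType) (p : nat) (x y : 'rV[R]_p) : R :=
  \sum_(i < p) x 0 i * y 0 i.

Definition enorm (R : realType) (p : nat) (x : 'rV[R]_p) : R :=
  Num.sqrt (inner x x).

Definition usphere (R : realType) (p : nat) : set 'rV[R]_p :=
  [set x | enorm x = 1].

(* K_c(R^p) is represented as a set of subsets of R^p. *)
Definition Kc (R : realType) (p : nat) : set (set 'rV[R]_p) :=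
  [set K : set 'rV[R]_p | [/\ K !=set0, compact K & convex_set K]].

Definition msum (R : realType) (p : nat) (K L : set 'rV[R]_p) : set 'rV[R]_p :=
  [set k + l | k in K & l in L].

Definition mscale (R : realType) (p : nat) (c : R) (K : set 'rV[R]_p) :
  set 'rV[R]_p := [set c *: k | k in K].

Definition Kc_convex (R : realType) (p : nat) (U : set (set 'rV[R]_p)) : Prop :=
  U `<=` @Kc R p /\
  forall (K L : set 'rV[R]_p) (l : R), U K -> U L -> 0 <= l <= 1 ->
    U (msum (mscale (1 - l) K) (mscale l L)).

(* The real supremum is a junk value on empty or unbounded sets; it is only
   used below for nonempty compact K. *)
Definition supp_fun (R : realType) (p : nat) (K : set 'rV[R]_p)
  (u : 'rV[R]_p) : R := sup [set inner k u | k in K].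

Definition random_set (R : realType) (p : nat) (d : measure_display)
    (Omega : measurableType d) (Gamma : Omega -> set 'rV[R]_p) : Prop :=
  (forall w, Kc (Gamma w)) /\
  (forall K, Kc K -> measurable [set w | (Gamma w `&` K) !=set0]).

Definition half_le (R : realType) (p : nat) (u : 'rV[R]_p) (t : R) :
  set (set 'rV[R]_p) := [set K | Kc K /\ supp_fun K u <= t].

Definition half_ge (R : realType) (p : nat) (u : 'rV[R]_p) (t : R) :
  set (set 'rV[R]_p) := [set K | Kc K /\ t <= supp_fun K u].

(* [P] is extended-real valued, hence so is the depth; in the index sets,
   a pair [ut] stands for (u, t). *)
Definition tukey_depth (R : realType) (p : nat) (d : measure_display)
    (Omega : measurableType d) (P : probability Omega R)
    (Gamma : Omega -> set 'rV[R]_p) (K : set 'rV[R]_p) : \bar R :=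
  Order.min
    (ereal_inf [set P (Gamma @^-1` half_le ut.1 ut.2) | ut in
       [set ut : 'rV[R]_p * R | usphere ut.1 /\ half_le ut.1 ut.2 K]])
    (ereal_inf [set P (Gamma @^-1` half_ge ut.1 ut.2) | ut in
       [set ut : 'rV[R]_p * R | usphere ut.1 /\ half_ge ut.1 ut.2 K]]).

Definition depth_region (R : realType) (p : nat) (d : measure_display)
    (Omega : measurableType d) (P : probability Omega R)
    (Gamma : Omega -> set 'rV[R]_p) (alpha : R) : set (set 'rV[R]_p) :=
  [set K | Kc K /\ (alpha%:E <= tukey_depth P Gamma K)%E].

(* Main.v *)
Require Import Defs.
From HB Require Import structures.
From mathcomp Require Import all_boot all_order all_algebra.
From mathcomp Require Import all_classical all_reals all_analysis.
From mathcomp Require Import ring lra.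
Import Order.TTheory GRing.Theory Num.Theory.
Import numFieldNormedType.Exports.

Local Open Scope classical_set_scope.
Local Open Scope ring_scope.

(** The region is convex because each map K |-> s_K(u) is affine for Minkowski
    combinations: with M = (1 - l) K + l L,
    s_M(u) = (1 - l) s_K(u) + l s_L(u) ([supp_fun_comb]).  This number lies
    between s_K(u) and s_L(u) ([convex_comb_between]), so a halfspace S^-_{u,t}
    or S^+_{u,t} containing M contains K or L.  If both K and L have depth at
    least alpha, the halfspace therefore has probability at least alpha; as it
    was an arbitrary halfspace containing M, the depth of M is at least alpha.

    Affinity of the support function rests on compactness, which makes the
    supremum a maximum ([supp_fun_attained]): if x and y maximize the inner
    product with u on K and L, then (1 - l) x + l y maximizes it on M. *)

Lemma convex_comb_between (R : realFieldType) (a b l : R) :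
  0 <= l -> l <= 1 -> Num.min a b <= (1 - l) * a + l * b <= Num.max a b.
Proof. by move=> l0 l1; case: (leP a b) => hab; apply/andP; split; nra. Qed.

Lemma inner_comb (R : realType) (p : nat) (a b : R) (x y u : 'rV[R]_p) :
  inner (a *: x + b *: y) u = a * inner x u + b * inner y u.
Proof.
rewrite /inner !mulr_sumr -big_split /=.
by apply: eq_bigr => i _; rewrite !mxE mulrDl !mulrA.
Qed.

Lemma continuous_inner (R : realType) (p : nat) (u : 'rV[R]_p) :
  continuous (fun x : 'rV[R]_p => inner x u).
Proof.
move=> x; rewrite /inner.
apply: (@cvg_big _ _ _ _ _ _ _ (nbhs x)) => [|i _].
- exact: add_continuous.
- apply: (@cvgM _ _ (nbhs x)); [exact: coord_continuous | exact: cvg_cst].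
Qed.

Lemma supp_fun_max (R : realType) (p : nat) (K : set 'rV[R]_p)
    (u k0 : 'rV[R]_p) :
  K k0 -> (forall k, K k -> inner k u <= inner k0 u) ->
  supp_fun K u = inner k0 u.
Proof.
move=> Kk0 k0max; apply/eqP; rewrite eq_le; apply/andP; split.
  apply: ge_sup; first by exists (inner k0 u), k0.
  by move=> _ [k Kk <-]; exact: k0max.
apply: ub_le_sup; last by exists k0.
by exists (inner k0 u) => _ [k Kk <-]; exact: k0max.
Qed.

(** Compactness of K and continuity of <., u> turn the supremum defining s_K(u)
    into a maximum. *)
Lemma supp_fun_attained (R : realType) (p : nat) (K : set 'rV[R]_p)
    (u : 'rV[R]_p) :
  Kc K -> exists k0, [/\ K k0, supp_fun K u = inner k0 u &
                         forall k, K k -> inner k u <= inner k0 u].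
Proof.
case=> K0 cK _.
have [|k0 Kk0 k0max] := @EVT_max_rV R p (fun x => inner x u) K K0 cK.
  exact/continuous_subspaceT/continuous_inner.
have {}k0max k : K k -> inner k u <= inner k0 u.
  by move=> Kk; apply: k0max; rewrite inE.
have {}Kk0 : K k0 by rewrite inE in Kk0.
by exists k0; split=> //; exact: supp_fun_max.
Qed.

(** Multiplication by a and b preserves the inequalities that make k0 and l0
    maximizers, because a and b are nonnegative; hence a k0 + b l0 maximizes
    <., u> on the combination. *)
Lemma supp_fun_comb (R : realType) (p : nat) (K L : set 'rV[R]_p) (a b : R)
    (u : 'rV[R]_p) :
  Kc K -> Kc L -> 0 <= a -> 0 <= b ->
  supp_fun (Defs.msum (Defs.mscale a K) (Defs.mscale b L)) u =
    a * supp_fun K u + b * supp_fun L u.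
Proof.
move=> hK hL a0 b0.
have [k0 [Kk0 -> k0max]] := supp_fun_attained _ _ _ u hK.
have [l0 [Ll0 -> l0max]] := supp_fun_attained _ _ _ u hL.
rewrite -inner_comb; apply: supp_fun_max.
  by exists (a *: k0); [exists k0 | exists (b *: l0); [exists l0|]].
move=> _ [_ [k Kk <-] [_ [l Ll <-] <-]]; rewrite !inner_comb.
by apply: lerD; apply: ler_wpM2l => //; [exact: k0max | exact: l0max].
Qed.

Lemma Kc_comb (R : realType) (p : nat) (K L : set 'rV[R]_p) (a b : R) :
  Kc K -> Kc L -> Kc (Defs.msum (Defs.mscale a K) (Defs.mscale b L)).
Proof.
move=> [[k0 Kk0] cK vK] [[l0 Ll0] cL vL]; split.
- by exists (a *: k0 + b *: l0), (a *: k0);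
    [exists k0 | exists (b *: l0); [exists l0|]].
- (* As an image of K x L, the combination inherits compactness. *)
  have -> : Defs.msum (Defs.mscale a K) (Defs.mscale b L) =
      (fun z : 'rV[R]_p * 'rV[R]_p => a *: z.1 + b *: z.2) @` (K `*` L).
    apply/seteqP; split => [_ [_ [k Kk <-] [_ [l Ll <-] <-]]|].
      by exists (k, l).
    move=> _ [[k l] [Kk Ll] <-].
    by exists (a *: k); [exists k | exists (b *: l); [exists l|]].
  apply: continuous_compact; last exact: compact_setX.
  apply: continuous_subspaceT => z.
  apply: cvgD; apply: cvgZr; [exact: cvg_fst | exact: cvg_snd].
- move=> x y m; rewrite !inE.
  move=> [_ [k Kk <-] [_ [l Ll <-] <-]] [_ [k' Kk' <-] [_ [l' Ll' <-] <-]].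
  have kk := vK k k' m (mem_set Kk) (mem_set Kk').
  have ll := vL l l' m (mem_set Ll) (mem_set Ll').
  rewrite !inE in kk ll.
  exists (a *: conv m (k : convex_lmodType _) (k' : convex_lmodType _)).
    by eexists; [exact: kk|].
  exists (b *: conv m (l : convex_lmodType _) (l' : convex_lmodType _)).
    by eexists; [exact: ll|].
  by apply/rowP => i; rewrite !mxE; ring.
Qed.

(** Replaces comparison of infima, whose index sets differ for K, L and their
    combination, by an argument about one fixed halfspace at a time. *)
Lemma tukey_depth_geP (R : realType) (p : nat) (d : measure_display)
    (Omega : measurableType d) (P : probability Omega R)
    (Gamma : Omega -> set 'rV[R]_p) (K : set 'rV[R]_p) (x : \bar R) :
  (x <= tukey_depth P Gamma K)%E <->
  forall u t, usphere u ->
    (half_le u t K -> (x <= P (Gamma @^-1` half_le u t))%E) /\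
    (half_ge u t K -> (x <= P (Gamma @^-1` half_ge u t))%E).
Proof.
rewrite /tukey_depth le_min; split=> [/andP[hle hge] u t hu | h].
  split=> hK.
    by apply: (le_trans hle); apply: ereal_inf_lbound; exists (u, t).
  by apply: (le_trans hge); apply: ereal_inf_lbound; exists (u, t).
apply/andP; split; apply: le_ereal_inf_tmp => _ [[u t] [/= hu hK] <-];
  by have [hle hge] := h u t hu; auto.
Qed.

Theorem theorem4p11 (R : realType) (p : nat) (hp : (1 <= p)%N)
    (d : measure_display) (Omega : measurableType d) (P : probability Omega R)
    (Gamma : Omega -> set 'rV[R]_p) (hGamma : random_set Gamma)
    (alpha : R) (halpha : 0 <= alpha <= 1) :
  Kc_convex (depth_region P Gamma alpha).
Proof.
split=> [K [] //|K L l [hK /tukey_depth_geP dK] [hL /tukey_depth_geP dL]].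
move=> /andP[l0 l1]; have l1' : 0 <= 1 - l by rewrite subr_ge0.
split; first exact: Kc_comb.
apply/tukey_depth_geP => u t hu.
have [dKle dKge] := dK u t hu; have [dLle dLge] := dL u t hu.
have /andP[hmin hmax] :=
  convex_comb_between _ (supp_fun K u) (supp_fun L u) l l0 l1.
split=> -[_]; rewrite supp_fun_comb // => hM.
- have := le_trans hmin hM.
  by rewrite ge_min => /orP[sK|sL]; [exact: dKle | exact: dLle].
- have := le_trans hM hmax.
  by rewrite le_max => /orP[sK|sL]; [exact: dKge | exact: dLge].
Qed.
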